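(* Let $u_1 < u_2 < \cdots < u_n$ be a strictly increasing sequence of positive integers. Let $i_1 < \cdots < i_t$ be all the indices $i \in \{1,\dots,n-1\}$ for which $u_{i+1}-u_i > 1$, and write $g_j = u_{i_j+1}-u_{i_j}$ for $1 \le j \le t$. Then: (i) (Arithmetic) $$\sum_{i=1}^{n} u_i = (u_n-u_1+1)\left(\frac{u_1+u_n}{2}\right) - \sum_{j=1}^{t} (g_j-1)\left(u_{i_j}+\frac{g_j}{2}\right).$$ (ii) (Geometric) $$\sum_{i=1}^{n} \log(u_i) = \log\left(\frac{u_n!}{(u_1-1)!}\right) - \sum_{j=1}^{t} \log\left(\frac{(u_{i_j+1}-1)!}{u_{i_j}!}\right).$$ (iii) (Harmonic) $$\sum_{i=1}^{n} \frac{1}{u_i} = H_{u_n} - H_{u_1-1} - \sum_{j=1}^{t} \left(H_{u_{i_j+1}-1} - H_{u_{i_j}}\right).$$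
   Context: $H_k = \sum_{i=1}^k \frac1i$ is the $k$-th harmonic number, with $H_0 = 0$. Here $u_{i_j+1}$ denotes the term of the sequence with index $i_j+1$. *)

(* Defs.v *)
From HB Require Import structures.
From mathcomp Require Import all_boot all_order all_algebra.
From mathcomp Require Import all_classical all_reals all_analysis.

Set Implicit Arguments.
Unset Strict Implicit.
Unset Printing Implicit Defensive.

Import Order.TTheory GRing.Theory Num.Theory.
Local Open Scope ring_scope.

(* The library's [harmonic] is the shifted summand k |-> 1/(k+1), so this is
   [series harmonic k]. *)
Definition harmonic_number {R : realType} (k : nat) : R :=
  \sum_(1 <= i < k.+1) i%:R^-1.

(* Main.v *)
Require Import Defs.
From mathcomp Require Import all_boot all_order all_algebra.
From mathcomp Require Import all_classical all_reals all_analysis.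
From mathcomp Require Import zify ring.

Import Order.TTheory GRing.Theory Num.Theory.
Local Open Scope ring_scope.

(** All three identities are one telescoping argument.  If [f k] is the
    backward difference [F k - F k.-1] of a function [F], then summing over
    the interval of integers from [u 1] to [u n] gives [F (u n) - F (u 1).-1];
    the sequence [u] omits from this interval exactly the integers strictly
    between [u i] and [u i.+1], which account for [F (u i.+1).-1 - F (u i)]
    ([sum_backward_difference]).  That correction vanishes when
    [u i.+1 = (u i).+1], so only the indices of proper gaps contribute, and
    these are listed once each by [idx] ([sum_support_enum]).  The three cases
    are the primitives [F k = k * (k + 1) / 2], [F k = ln k`!] and
    [F k = harmonic_number k]. *)

(** The terms [F (u i)] and [F (u i.+1).-1] are paired across the step from
    [i] to [i.+1]; only the two extreme ones are left over. *)
Lemma sum_backward_difference (V : zmodType) (F : nat -> V) (u : nat -> nat)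
    (n : nat) :
  \sum_(1 <= i < n.+2) (F (u i) - F (u i).-1) =
    F (u n.+1) - F (u 1%N).-1 - \sum_(1 <= i < n.+1) (F (u i.+1).-1 - F (u i)).
Proof.
rewrite !sumrB big_nat_recr // [X in _ - X]big_nat_recl //=.
by rewrite opprB [X in X - _]addrC opprD addrACA.
Qed.

Lemma increasing_injective (t : nat) (idx : nat -> nat) :
    (forall j k : nat, (1 <= j)%N -> (j < k)%N -> (k <= t)%N ->
       (idx j < idx k)%N) ->
  {in index_iota 1 t.+1 &, injective idx}.
Proof.
move=> idx_incr j k; rewrite !mem_index_iota !ltnS.
move=> /andP[j_gt0 j_le] /andP[k_gt0 k_le] eq_idx.
case: (ltngtP j k) => // lt_jk.
  by have := idx_incr _ _ j_gt0 lt_jk k_le; rewrite eq_idx ltnn.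
by have := idx_incr _ _ k_gt0 lt_jk j_le; rewrite eq_idx ltnn.
Qed.

(** By injectivity, [idx] lists without repetition the indices satisfying [P],
    so the right-hand side is a reordering of the left-hand side with its zero
    terms deleted. *)
Lemma sum_support_enum (V : nmodType) (W : nat -> V) (P : pred nat)
    (n t : nat) (idx : nat -> nat) :
    {in index_iota 1 t.+1 &, injective idx} ->
    (forall i, (1 <= i < n)%N /\ P i <->
       exists j, (1 <= j <= t)%N /\ idx j = i) ->
    (forall i, (1 <= i < n)%N -> ~~ P i -> W i = 0) ->
  \sum_(1 <= i < n) W i = \sum_(1 <= j < t.+1) W (idx j).
Proof.
move=> idx_inj idxP W0.
rewrite -(big_map idx predT W) (bigID P) /=.
rewrite [X in _ + X]big_nat_cond [X in _ + X]big1 ?addr0; last first.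
  by move=> i /andP[/W0].
rewrite -big_filter; apply: perm_big; apply: uniq_perm.
- by rewrite filter_uniq ?iota_uniq.
- by rewrite map_inj_in_uniq ?iota_uniq.
move=> i; rewrite mem_filter mem_index_iota.
apply/andP/mapP => [[Pi i_in]|[j j_in ->]].
  have /idxP[j [j_in <-]] : (1 <= i < n)%N /\ P i by [].
  by exists j; rewrite ?mem_index_iota.
have [//|? ?] := (idxP (idx j)).2; last by [].
by exists j; move: j_in; rewrite mem_index_iota.
Qed.

(** The three identities at once: a primitive [F] of [f] gives the sum of [f]
    over the whole interval from [u 1] to [u n] and over each omitted block. *)
Lemma sum_gaps (V : zmodType) (f F : nat -> V) (n : nat) (u : nat -> nat)
    (t : nat) (idx : nat -> nat) :
    (forall k, (0 < k)%N -> f k = F k - F k.-1) ->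
    (0 < n)%N ->
    (forall i, (1 <= i <= n)%N -> (0 < u i)%N) ->
    (forall i k, (1 <= i)%N -> (i < k)%N -> (k <= n)%N -> (u i < u k)%N) ->
    {in index_iota 1 t.+1 &, injective idx} ->
    (forall i : nat, ((1 <= i <= n - 1)%N /\ (1 < u i.+1 - u i)%N) <->
       (exists j : nat, (1 <= j <= t)%N /\ idx j = i)) ->
  \sum_(1 <= i < n.+1) f (u i) =
    F (u n) - F (u 1%N - 1)%N
    - \sum_(1 <= j < t.+1) (F (u (idx j).+1 - 1)%N - F (u (idx j))).
Proof.
move=> fF n_gt0 u_pos u_incr idx_inj idxP.
transitivity (\sum_(1 <= i < n.+1) (F (u i) - F (u i).-1)).
  by apply: eq_big_nat => i i_in; rewrite fF // u_pos.
case: n n_gt0 u_pos u_incr idxP => // n _ u_pos u_incr idxP.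
rewrite sum_backward_difference subn1; congr (_ - _).
under [in RHS]eq_bigr do rewrite subn1.
apply: (sum_support_enum V (fun i => F (u i.+1).-1 - F (u i))
          (fun i => 1 < u i.+1 - u i)%N) => //.
  by move=> i; rewrite -idxP subn1 ltnS.
(* A gap that is not greater than 1 equals 1, since [u] increases. *)
move=> i /andP[i_gt0 i_le]; rewrite -leqNgt => gap_le1.
have u_lt := u_incr _ _ i_gt0 (ltnSn i) i_le.
by have -> : (u i.+1).-1 = u i by [lia]; rewrite subrr.
Qed.

Theorem corollary3p3 (R : realType) (n : nat) (u : nat -> nat)
    (n_gt0 : (0 < n)%N)
    (u_pos : forall i : nat, (1 <= i <= n)%N -> (0 < u i)%N)
    (u_incr : forall i k : nat, (1 <= i)%N -> (i < k)%N -> (k <= n)%N ->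
       (u i < u k)%N)
    (t : nat) (idx : nat -> nat)
    (idx_incr : forall j k : nat, (1 <= j)%N -> (j < k)%N -> (k <= t)%N ->
       (idx j < idx k)%N)
    (idx_all : forall i : nat,
       ((1 <= i <= n - 1)%N /\ (1 < u i.+1 - u i)%N) <->
       (exists j : nat, (1 <= j <= t)%N /\ idx j = i))
    (g : nat -> nat)
    (g_def : forall j : nat, (1 <= j <= t)%N ->
       g j = (u (idx j).+1 - u (idx j))%N) :
  [/\ \sum_(1 <= i < n.+1) (u i)%:R =
        ((u n)%:R - (u 1%N)%:R + 1) * (((u 1%N)%:R + (u n)%:R) / 2)
        - \sum_(1 <= j < t.+1)
            ((g j)%:R - 1) * ((u (idx j))%:R + (g j)%:R / 2) :> R,
      \sum_(1 <= i < n.+1) ln (u i)%:R =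
        ln ((u n)`!%:R / (u 1%N - 1)`!%:R)
        - \sum_(1 <= j < t.+1)
            ln ((u (idx j).+1 - 1)`!%:R / (u (idx j))`!%:R) :> R
    & \sum_(1 <= i < n.+1) (u i)%:R^-1 =
        harmonic_number (u n) - harmonic_number (u 1%N - 1)%N
        - \sum_(1 <= j < t.+1)
            (harmonic_number (u (idx j).+1 - 1)%N
             - harmonic_number (u (idx j))) :> R].
Proof.
have idx_inj := increasing_injective _ _ idx_incr.
have idx_in j : (1 <= j <= t)%N ->
    (1 <= idx j <= n - 1)%N /\ (1 < u (idx j).+1 - u (idx j))%N.
  by move=> j_in; apply/idx_all; exists j.
split.
- pose T (k : nat) : R := k%:R * (k%:R + 1) / 2.
  rewrite (sum_gaps R (fun k => k%:R) T n u t idx) //; last first.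
    by case=> // k _; rewrite /T /= -natr1; field.
  have u1_gt0 : (0 < u 1%N)%N by rewrite u_pos.
  congr (_ - _); first by rewrite /T natrB //; field.
  apply: eq_big_nat => j j_in; have [_ gap_gt1] := idx_in _ j_in.
  rewrite /T g_def // !natrB; [by field|lia..].
- have fact_pos k : (k`!%:R : R) \is Num.pos by rewrite posrE ltr0n fact_gt0.
  rewrite (sum_gaps R (fun k => ln k%:R) (fun k => ln k`!%:R) n u t idx) //.
    rewrite ln_div //; congr (_ - _).
    by apply: eq_bigr => j _; rewrite ln_div.
  case=> // k _ /=; rewrite factS natrM lnM ?posrE ?ltr0n ?fact_gt0 //.
  by rewrite addrK.
- rewrite (sum_gaps R (fun k => k%:R^-1) harmonic_number n u t idx) //.
  by case=> // k _; rewrite /harmonic_number big_nat_recr //= addrAC subrr add0r.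
Qed.
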